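(* Let $\mathcal{X}=[0,1]^d$, let $\sigma>0$, and let $\mathcal{H}$ be the reproducing kernel Hilbert space of the squared exponential kernel $k(x,y)=\exp\{-\|x-y\|^2/\sigma^2\}$ on $\mathbb{R}^d$. For $R>0$ let $S=\{f\in\mathcal{H}:\|f\|_{\mathcal{H}}\le R\}$. If there exists a deterministic algorithm that achieves simple regret $r_{(T)}\le\epsilon$ for every function $f\in S$ in $T$ function evaluations for the problem $\min_{x\in\mathcal{X}}f(x)$, then it is necessary that $$T=\Omega\left(\left(\log\frac{R}{\epsilon}\right)^{d/2-1}\right).$$ Furthermore, there exist a deterministic algorithm and $T$ satisfying $$T=\mathcal{O}\left(\left(\log\frac{R}{\epsilon}\right)^{d}\right)$$ such that the algorithm achieves $r_{(T)}\le\epsilon$ in $T$ function evaluations for every $f\in S$. Explicitly: there exist constants $c,C>0$ and $\eta_0\in(0,1)$, which may depend on $d$ and $\sigma$ but not on $R$, $\epsilon$, $T$ or the algorithm, such that for all $R>0$ and $\epsilon>0$ with $\epsilon/R<\eta_0$: (i) if for some positive integer $T$ a deterministic algorithm has $r_{(T)}\le\epsilon$ for all $f\in S$, then $T\ge c\,(\log(R/\epsilon))^{d/2-1}$; (ii) there exist a positive integer $T\le C\,(\log(R/\epsilon))^{d}$ and a deterministic algorithm (which may depend on $R$ and $\epsilon$) with $r_{(T)}\le\epsilon$ for all $f\in S$.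
   Context: $\|x-y\|$ is the Euclidean norm on $\mathbb{R}^d$; $\mathcal{H}$ consists of functions $\mathbb{R}^d\to\mathbb{R}$ with RKHS norm $\|\cdot\|_{\mathcal{H}}$. Deterministic algorithm: a sequence of mappings $(\pi_t)_{t\ge1}$ with $\pi_1:\{\emptyset\}\to\mathcal{X}$ and $\pi_t:(\mathcal{X}\times\mathbb{R})^{t-1}\to\mathcal{X}$ for $t\ge2$. Run on $f$, it evaluates $f$ (noiselessly) at $x_1=\pi_1(\emptyset)$ and $x_t=\pi_t\big((x_\tau,f(x_\tau))_{\tau=1}^{t-1}\big)$ for $t\ge2$. Simple regret after $t$ evaluations: $r_{(t)}=\min_{1\le\tau\le t}f(x_\tau)-\min_{x\in\mathcal{X}}f(x)$. $\log$ is the natural logarithm. *)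

(* Defs.v *)
From HB Require Import structures.
From mathcomp Require Import all_boot all_order all_algebra.
From mathcomp Require Import all_classical all_reals all_analysis.

Set Implicit Arguments.
Unset Strict Implicit.
Unset Printing Implicit Defensive.

Import Order.TTheory GRing.Theory Num.Theory.
Import numFieldNormedType.Exports.

Local Open Scope classical_set_scope.
Local Open Scope ring_scope.

(* A real Hilbert space whose elements are functions X -> R. The inner product
   is a total function on X -> R, constrained only on the carrier. *)
Record function_hilbert_space (R : realType) (X : Type) := FunctionHilbertSpace {
  fhs_carrier : set (X -> R);
  inner : (X -> R) -> (X -> R) -> R;
  fhs_zero : fhs_carrier (fun=> 0);
  fhs_linear : forall (a : R) (f g : X -> R),
    fhs_carrier f -> fhs_carrier g -> fhs_carrier (a \*o f \+ g);
  inner_sym : forall f g : X -> R,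
    fhs_carrier f -> fhs_carrier g -> inner f g = inner g f;
  inner_linear : forall (a : R) (f g h : X -> R),
    fhs_carrier f -> fhs_carrier g -> fhs_carrier h ->
    inner (a \*o f \+ g) h = a * inner f h + inner g h;
  inner_ge0 : forall f : X -> R, fhs_carrier f -> 0 <= inner f f;
  inner_eq0 : forall f : X -> R,
    fhs_carrier f -> inner f f = 0 -> f = (fun=> 0);
  fhs_complete : forall u : nat -> X -> R,
    (forall n, fhs_carrier (u n)) ->
    (forall e : R, 0 < e -> exists N : nat, forall m n : nat,
       (N <= m)%N -> (N <= n)%N ->
       Num.sqrt (inner (u m \- u n) (u m \- u n)) < e) ->
    exists f : X -> R, fhs_carrier f /\
      (Num.sqrt (inner (u n \- f) (u n \- f)) @[n --> \oo] --> (0 : R))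
}.

Definition hnorm (R : realType) (X : Type) (H : function_hilbert_space R X)
  (f : X -> R) : R := Num.sqrt (inner H f f).

Definition is_rkhs_of (R : realType) (X : Type)
    (H : function_hilbert_space R X) (k : X -> X -> R) : Prop :=
  forall x : X, fhs_carrier H (k ^~ x) /\
    (forall f : X -> R, fhs_carrier H f -> f x = inner H f (k ^~ x)).

Definition hball (R : realType) (X : Type) (H : function_hilbert_space R X)
    (r : R) : set (X -> R) :=
  [set f | fhs_carrier H f /\ hnorm H f <= r].

(* The library norm `|x| on 'rV[R]_d is the maximum norm. *)
Definition enorm (R : realType) (d : nat) (x : 'rV[R]_d) : R :=
  Num.sqrt (\sum_(i < d) x ord0 i ^+ 2).

Definition se_kernel (R : realType) (d : nat) (sigma : R)
    (x y : 'rV[R]_d) : R :=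
  expR (- (enorm (x - y) ^+ 2 / sigma ^+ 2)).

Definition unit_cube (R : realType) (d : nat) : set 'rV[R]_d :=
  [set x | forall i : 'I_d, 0 <= x ord0 i <= 1].
Arguments unit_cube : clear implicits.

(* Times are 0-based: [pi t] maps the t observations made so far to the point
   of the (t+1)-st evaluation. *)
Definition det_algorithm (R : realType) (X : Type) :=
  forall t : nat, t.-tuple (X * R) -> X.

Fixpoint history (R : realType) (X : Type) (pi : det_algorithm R X)
    (f : X -> R) (t : nat) : t.-tuple (X * R) :=
  match t with
  | 0 => [tuple]
  | t'.+1 => let h := history pi f t' in
             let x := pi t' h in [tuple of rcons h (x, f x)]
  end.

Definition query (R : realType) (X : Type) (pi : det_algorithm R X)
    (f : X -> R) (t : nat) : X := pi t (history pi f t).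

(* [query pi f 0] is always among the evaluated points when 0 < T, so the
   iterated minimum is the best observed value. The infimum is a minimum
   for f continuous and X compact. *)
Definition simple_regret (R : realType) (X : Type) (pi : det_algorithm R X)
    (f : X -> R) (T : nat) : R :=
  \big[Num.min/f (query pi f 0)]_(t < T) f (query pi f t) - inf (range f).

Definition achieves_regret (R : realType) (U : Type) (X : set U)
    (pi : det_algorithm R X) (S : set (U -> R)) (T : nat) (eps : R) : Prop :=
  forall f : U -> R, S f -> simple_regret pi (fun x : X => f (val x)) T <= eps.

(* Main.v *)
Require Import Defs.
From HB Require Import structures.
From mathcomp Require Import all_boot all_order all_algebra.
From mathcomp Require Import all_classical all_reals all_analysis.
From mathcomp Require Import ring lra.

(* Upper bound. Up to Gaussian weights the one-dimensional kernel is
   exp(2 s t / sigma^2), which Lagrange interpolation in s at n equispaced nodes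
   approximates with error C^n / n!. Tensorising, k(., x) is within exp(-n) / 6
   in norm of the span of the kernel sections at the n^d grid points, so two
   functions of the ball that agree on the grid are uniformly close on the cube.
   Sampling the grid and then querying a near-minimiser of any function of the
   ball consistent with the samples is therefore enough, with n ~ log(R / eps).

   Lower bound. The adversary answers 0 to all T < n^d queries. Some nonzero
   combination f of the n^d kernel sections at the grid vanishes on the queries.
   The Gram matrix of the grid is a tensor power of a matrix that is Vandermonde
   up to diagonal factors, with nodes q^m where q = exp(2 / (sigma n)^2), so its
   inverse is at most exp(C n^2) and the norm of f is at most exp(C' n^2) times
   its largest value on the grid. Hence log(R / eps) <= C'' n^2, which even gives
   T of order log(R / eps)^(d / 2). *)

Set Implicit Arguments.
Unset Strict Implicit.
Unset Printing Implicit Defensive.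

Import Order.TTheory GRing.Theory Num.Theory.
Import numFieldNormedType.Exports.

Local Open Scope classical_set_scope.
Local Open Scope ring_scope.

(** * Taylor remainder of the exponential and factorial decay *)

Lemma exp_coeff_le_expR (R : realType) (y : R) (n : nat) :
  0 <= y -> y ^+ n / n`!%:R <= expR y.
Proof.
move=> y0; case: n => [|n]; last by have := expR_ge1Dxn n y0; lra.
by rewrite expr0 fact0 divr1; have := expR_ge1Dx y; lra.
Qed.

(** Since n! j! <= (n + j)!, the tail term of index n + j is at most y^n / n! times the j-th term of
    the series of exp(y). Summing over j gives the upper bound. *)
Lemma expR_taylor_remainder (R : realType) (y : R) (n : nat) : 0 <= y ->
  0 <= expR y - \sum_(m < n) y ^+ m / m`!%:R <= y ^+ n / n`!%:R * expR y.
Proof.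
move=> y0.
have cvgs : series (exp_coeff y) @ \oo --> expR y.
  by apply: is_cvg_series_exp_coeff.
have sE m : series (exp_coeff y) m = \sum_(j < m) y ^+ j / j`!%:R.
  by rewrite /series /= big_mkord.
have le1 m : series (exp_coeff y) m <= expR y.
  apply: nondecreasing_cvgn_le; last exact: is_cvg_series_exp_coeff.
  by apply/nondecreasing_seqP => k; rewrite seriesSr lerDl exp_coeff_ge0.
apply/andP; split; first by rewrite subr_ge0 -sE.
rewrite lerBlDr.
have cvgs' : [sequence series (exp_coeff y) (n + m)%N]_m @ \oo --> expR y.
  by rewrite -(cvg_shiftn n) in cvgs; under eq_fun do rewrite addnC.
rewrite -[leLHS](cvg_lim _ cvgs') //.
apply: limr_le; first by apply: cvgP cvgs'.
apply: nearW => m.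
rewrite /= sE big_split_ord /= addrC lerD2r.
apply: (@le_trans _ _ (\sum_(j < m) y ^+ n / n`!%:R * (y ^+ j / j`!%:R))).
  apply: ler_sum => j _.
  rewrite exprD mulf_div ler_wpM2l ?mulr_ge0 ?exprn_ge0 //.
  rewrite lef_pV2 ?posrE ?mulr_gt0 ?ltr0n ?fact_gt0 //.
  rewrite -natrM ler_nat -(@bin_fact (n + j) n) ?leq_addr // addKn.
  by rewrite leq_pmull // bin_gt0 leq_addr.
rewrite -big_distrr /= ler_wpM2l ?mulr_ge0 ?exprn_ge0 ?invr_ge0 ?ler0n //.
by rewrite -sE.
Qed.

(** The terms of the exponential series at [b * expR 1] tend to 0. This lets n! absorb all constants
    and geometric factors of the interpolation error and still leave exp(-n). *)
Lemma geometric_le_fact_expR (R : realType) (a b : R) :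
  exists N : nat, forall n, (N <= n)%N ->
    a * b ^+ n / n`!%:R <= expR (- n%:R).
Proof.
have : (fun n => a * exp_coeff (b * expR 1) n) @ \oo --> (0 : R).
  by rewrite -[X in _ --> X](mulr0 a); apply: cvgMr; exact: cvg_exp_coeff.
move=> /cvgrPdist_le /(_ 1 ltr01) [N _ hN]; exists N => n Nn.
have /= := hN n Nn; rewrite sub0r normrN => /(le_trans (ler_norm _)).
rewrite /exp_coeff /= exprMn -expRM_natr mul1r => h.
rewrite expRN -[leRHS]mul1r ler_pdivlMr ?expR_gt0 //.
by move: h; congr (_ <= _); ring.
Qed.

(** * Lagrange interpolation at equispaced nodes *)

Lemma prod_dist_nat (R : realType) (n i : nat) : (i < n)%N ->
  \prod_(j < n | (j : nat) != i) `|i%:R - j%:R| = (i`! * (n - i.+1)`!)%:R :> R.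
Proof.
move=> lt_in; rewrite -(big_mkord (fun j => j != i) (fun j => `|i%:R - j%:R|)).
(* The indices below [i] contribute i!; induction on how many lie above [i] builds the other
   factorial. *)
rewrite -{1}(subnKC lt_in); elim: (n - i.+1)%N => [|m IH].
  rewrite addn0 fact0 muln1 big_mkcond big_nat_recr //= eqxx mulr1.
  rewrite big_nat_rev /= add0n.
  under eq_big_nat => j /andP[_ ji].
    have -> : (i - j.+1 != i)%N by rewrite neq_ltn ltn_subrL (leq_trans _ ji).
    rewrite natrB // opprB addrC subrK normr_nat.
    over.
  by rewrite fact_prod big_add1 /= natr_prod.
rewrite addnS big_mkcond big_nat_recr //= -big_mkcond IH.
rewrite gtn_eqF ?leq_addr //= distrC addSn -addnS natrD addrC addKr normr_nat.
by rewrite -natrM factS (mulnC m.+1) mulnA.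
Qed.

Definition lagrange_at {F : fieldType} {n : nat} (x : nat -> F) (i : 'I_n)
  (s : F) : F := (tnth (n.-lagrange x) i : {poly F}).[s].

Lemma lagrange_horner (F : fieldType) (n : nat) (x : nat -> F) (i : 'I_n)
    (s : F) : (0 < n)%N -> injective x ->
  lagrange_at x i s =
    \prod_(j < n | j != i) (x i - x j)^-1 * \prod_(j < n | j != i) (s - x j).
Proof.
move=> n0 xinj; rewrite /lagrange_at lagrangeE //= hornerCM !horner_prod prodfV.
by congr (_^-1 * _); apply: eq_bigr => j _; rewrite hornerXsubC.
Qed.

Definition equinode {R : realType} (n j : nat) : R := j%:R / n%:R.

Lemma equinode_inj (R : realType) (n : nat) :
  (0 < n)%N -> injective (@equinode R n).
Proof.
move=> n0 i j /mulIf h; apply/eqP; rewrite -(eqr_nat R); apply/eqP/h.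
by rewrite invr_eq0 pnatr_eq0 -lt0n.
Qed.

Lemma equinode_itv (R : realType) (n : nat) (j : 'I_n) :
  0 <= (equinode n j : R) <= 1.
Proof.
have n0 : (0 < n)%N by apply: leq_trans (ltn_ord j).
rewrite /equinode divr_ge0 //= ler_pdivrMr ?ltr0n // mul1r ler_nat.
exact: ltnW.
Qed.

(** The numerator factors are at most 1. The denominators give n^(n-1) / (i! (n-1-i)!), at most
    2^(n-1) n^(n-1) / (n-1)! because a binomial coefficient of n-1 is at most 2^(n-1). Finally
    n^(n-1) / (n-1)! = n^n / n! <= e^n. *)
Lemma equinode_lagrange_le (R : realType) (n : nat) (i : 'I_n) (s : R) :
  0 <= s <= 1 ->
  `|lagrange_at (equinode n) i s| <= (2 * expR 1) ^+ n.
Proof.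
move=> /andP[s0 s1]; have n0 : (0 < n)%N by apply: leq_trans (ltn_ord i).
rewrite lagrange_horner //; last exact: equinode_inj.
rewrite normrM -[leRHS]mulr1; apply: ler_pM => //; last first.
  rewrite normr_prod; apply: prodr_ile1 => j _; rewrite normr_ge0 /=.
  have /andP[] := equinode_itv R j; rewrite ler_norml; lra.
have -> : \prod_(j < n | j != i) (equinode n i - equinode n j)^-1 =
    n%:R ^+ n.-1 * (\prod_(j < n | j != i) (i%:R - j%:R))^-1 :> R.
  rewrite -prodfV; have -> : (n.-1 = #|[pred j : 'I_n | j != i]|)%N.
    by rewrite cardC1 card_ord.
  rewrite -prodr_const -big_split /=; apply: eq_bigr => j _.
  by rewrite /equinode -mulrBl invfM invrK mulrC.
rewrite normrM normrX normr_nat normfV normr_prod (prod_dist_nat _ (ltn_ord i)).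
have -> : (n - i.+1 = n.-1 - i)%N by case: n i n0 => // n i _; rewrite subSS.
have ile : (i <= n.-1)%N by rewrite -ltnS prednK.
have fle : (n.-1`! <= 2 ^ n.-1 * (i`! * (n.-1 - i)`!))%N.
  rewrite -(bin_fact ile) leq_mul2r; apply/orP; right.
  rewrite -[X in (_ <= X ^ _)%N]/(1 + 1)%N expnDn.
  rewrite (bigD1 (inord i : 'I_n.-1.+1)) //= inordK // !exp1n !muln1.
  exact: leq_addr.
rewrite exprMn.
apply: (@le_trans _ _ (2 ^+ n.-1 * (n%:R ^+ n.-1 / n.-1`!%:R))).
  rewrite mulrCA ler_wpM2l ?exprn_ge0 //.
  rewrite ler_pdivlMr ?ltr0n ?fact_gt0 // mulrC ler_pdivrMr.
    by rewrite -natrX -natrM ler_nat.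
  by rewrite ltr0n muln_gt0 !fact_gt0.
apply: ler_pM; rewrite ?mulr_ge0 ?exprn_ge0 //.
  by rewrite ler_eXn2l ?ltr1n // leq_pred.
have -> : n%:R ^+ n.-1 / n.-1`!%:R = n%:R ^+ n / n`!%:R :> R.
  case: (n) n0 => // m _ /=.
  by rewrite factS exprS natrM -mulf_div divff ?mul1r ?pnatr_eq0.
by rewrite -expRM_natr mul1r exp_coeff_le_expR.
Qed.

Lemma equinode_lebesgue_le (R : realType) (n : nat) (s : R) : 0 <= s <= 1 ->
  \sum_(i < n) `|lagrange_at (equinode n) i s| <=
    n%:R * (2 * expR 1) ^+ n.
Proof.
move=> s01; apply: (@le_trans _ _ (\sum_(i < n) (2 * expR 1) ^+ n)).
  by apply: ler_sum => i _; apply: equinode_lagrange_le.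
by rewrite sumr_const card_ord [leRHS]mulr_natl.
Qed.

(** Interpolation reproduces [p], so the error for [f] equals the error for [f - p], whose
    interpolant is controlled by the Lebesgue function. *)
Lemma lagrange_interp_error (R : realType) (n : nat) (x : nat -> R)
    (f : R -> R) (p : {poly R}) (s e : R) :
  (0 < n)%N -> injective x -> (size p <= n)%N ->
  `|f s - p.[s]| <= e -> (forall i : 'I_n, `|f (x i) - p.[x i]| <= e) ->
  `|f s - \sum_(i < n) lagrange_at x i s * f (x i)| <=
    (1 + \sum_(i < n) `|lagrange_at x i s|) * e.
Proof.
move=> n0 xinj sp es ex.
have ps : p.[s] = \sum_(i < n) lagrange_at x i s * p.[x i].
  rewrite {1}(lagrange_gen n0 xinj sp) horner_sum; apply: eq_bigr => i _.
  by rewrite hornerCM mulrC.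
have -> : f s - \sum_(i < n) lagrange_at x i s * f (x i) =
    (f s - p.[s]) -
    \sum_(i < n) lagrange_at x i s * (f (x i) - p.[x i]).
  under [in RHS]eq_bigr do rewrite mulrBr.
  by rewrite sumrB -ps; ring.
rewrite mulrDl mul1r (le_trans (ler_normB _ _)) // lerD // mulr_suml.
apply: le_trans (ler_norm_sum _ _ _) _; apply: ler_sum => i _.
by rewrite normrM ler_wpM2l.
Qed.

Lemma equinode_expR_error (R : realType) (n : nat) (c s t : R) :
  (0 < n)%N -> 0 <= c -> 0 <= s <= 1 -> 0 <= t <= 1 ->
  `|expR (c * s * t) - \sum_(i < n)
      lagrange_at (equinode n) i s * expR (c * equinode n i * t)|
  <= (1 + n%:R * (2 * expR 1) ^+ n) * (c ^+ n / n`!%:R * expR c).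
Proof.
move=> n0 c0 s01 t01.
(* The Taylor polynomial of u |-> exp(c u t). One error bound serves [s] and all nodes, since c u t
   stays in [0, c]. *)
pose p : {poly R} := \poly_(m < n) ((c * t) ^+ m / m`!%:R).
have near u : 0 <= u <= 1 ->
    `|expR (c * u * t) - p.[u]| <= c ^+ n / n`!%:R * expR c.
  move=> u01.
  have -> : p.[u] = \sum_(m < n) (c * u * t) ^+ m / m`!%:R.
    rewrite horner_poly; apply: eq_bigr => m _.
    by rewrite [c * u * t]mulrAC [in RHS]exprMn mulrAC.
  have y0 : 0 <= c * u * t by rewrite !mulr_ge0 //; lra.
  have yc : c * u * t <= c.
    rewrite -mulrA -[leRHS]mulr1 ler_wpM2l // mulr_ile1 //; lra.
  have /andP[h1 h2] := expR_taylor_remainder n y0.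
  rewrite ger0_norm // (le_trans h2) // ler_pM ?expR_ge0 ?ler_expR //.
    by rewrite mulr_ge0 ?exprn_ge0.
  by rewrite ler_wpM2r // lerXn2r ?nnegrE.
apply: le_trans (lagrange_interp_error (f := fun u => expR (c * u * t)) n0
  (@equinode_inj R n n0) (size_poly _ _) (near _ s01) _) _.
  by move=> i; apply/near/equinode_itv.
rewrite ler_wpM2r ?lerD2l ?equinode_lebesgue_le //.
by rewrite mulr_ge0 ?expR_ge0 // mulr_ge0 ?exprn_ge0.
Qed.

(** * The one-dimensional kernel and its interpolation *)

Definition se1 {R : realType} (sigma s t : R) : R :=
  expR (- ((s - t) ^+ 2 / sigma ^+ 2)).

Lemma se1C (R : realType) (sigma s t : R) : se1 sigma s t = se1 sigma t s.
Proof. by rewrite /se1 -sqrrN opprB. Qed.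

Lemma se1_le1 (R : realType) (sigma s t : R) : se1 sigma s t <= 1.
Proof. by rewrite -expR0 ler_expR oppr_le0 divr_ge0 ?sqr_ge0. Qed.

(** Both bounds rest on this splitting: the upper one interpolates the last factor in [s], the lower
    one reads it as a Vandermonde matrix on the grid. *)
Lemma se1E (R : realType) (sigma s t : R) :
  se1 sigma s t = expR (- (s ^+ 2 / sigma ^+ 2)) *
    expR (- (t ^+ 2 / sigma ^+ 2)) * expR (2 / sigma ^+ 2 * s * t).
Proof. by rewrite -!expRD; congr expR; ring. Qed.

Lemma se_kernelE (R : realType) (d : nat) (sigma : R) (x y : 'rV[R]_d) :
  se_kernel sigma x y = \prod_(l < d) se1 sigma (x ord0 l) (y ord0 l).
Proof.
rewrite /se_kernel /enorm sqr_sqrtr; last first.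
  by apply: sumr_ge0 => l _; rewrite sqr_ge0.
rewrite mulr_suml -sumrN expR_sum; apply: eq_bigr => l _.
by rewrite /se1 !mxE.
Qed.

Lemma se_kernelC (R : realType) (d : nat) (sigma : R) (x y : 'rV[R]_d) :
  se_kernel sigma x y = se_kernel sigma y x.
Proof. by rewrite !se_kernelE; apply: eq_bigr => l _; rewrite se1C. Qed.

Lemma se_kernel_le1 (R : realType) (d : nat) (sigma : R) (x y : 'rV[R]_d) :
  se_kernel sigma x y <= 1.
Proof.
by rewrite se_kernelE; apply: prodr_ile1 => l _; rewrite expR_ge0 se1_le1.
Qed.

(* Chosen so that \sum_i interp_weight i s * k(x_i, t) is the Gaussian weight at
   [s], [t] times the Lagrange interpolant of s |-> exp(2 s t / sigma^2). *)
Definition interp_weight {R : realType} (sigma : R) (n : nat) (i : 'I_n)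
  (s : R) : R :=
  lagrange_at (equinode n) i s *
  expR ((equinode n i ^+ 2 - s ^+ 2) / sigma ^+ 2).

Lemma interp_weight_sum_le (R : realType) (sigma : R) (n : nat) (s : R) :
  0 <= s <= 1 ->
  \sum_(i < n) `|interp_weight sigma i s| <=
    n%:R * (2 * expR 1) ^+ n * expR (sigma ^- 2).
Proof.
move=> s01; apply: le_trans (_ : _ <=
   (\sum_(i < n) `|lagrange_at (equinode n) i s|) * expR (sigma ^- 2)) _.
  rewrite mulr_suml; apply: ler_sum => i _; rewrite normrM ler_wpM2l //.
  rewrite ger0_norm ?expR_ge0 // ler_expR -[leRHS]mul1r.
  rewrite ler_wpM2r ?invr_ge0 ?sqr_ge0 //.
  have /andP[x0 x1] := equinode_itv R i.
  have := sqr_ge0 s; have : equinode n i ^+ 2 <= 1 :> R by rewrite expr_le1.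
  lra.
by rewrite ler_wpM2r ?expR_ge0 // equinode_lebesgue_le.
Qed.

Lemma se1_interp_error (R : realType) (sigma : R) (n : nat) (s t : R) :
  (0 < n)%N -> 0 <= s <= 1 -> 0 <= t <= 1 ->
  `|se1 sigma s t -
      \sum_(i < n) interp_weight sigma i s * se1 sigma (equinode n i) t| <=
  (1 + n%:R * (2 * expR 1) ^+ n) *
    ((2 / sigma ^+ 2) ^+ n / n`!%:R * expR (2 / sigma ^+ 2)).
Proof.
move=> n0 s01 t01; set c := 2 / sigma ^+ 2.
have c0 : 0 <= c by rewrite divr_ge0 ?sqr_ge0.
pose w := expR (- (s ^+ 2 / sigma ^+ 2)) * expR (- (t ^+ 2 / sigma ^+ 2)).
have -> : se1 sigma s t -
    \sum_(i < n) interp_weight sigma i s * se1 sigma (equinode n i) t =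
    w * (expR (c * s * t) -
      \sum_(i < n) lagrange_at (equinode n) i s * expR (c * equinode n i * t)).
  rewrite mulrBr -se1E mulr_sumr; congr (_ - _); apply: eq_bigr => i _.
  rewrite /interp_weight se1E -/c /w mulrBl expRD.
  rewrite (expRN (equinode n i ^+ 2 / _)).
  by field; rewrite gt_eqF ?expR_gt0.
have w0 : 0 <= w by rewrite mulr_ge0 ?expR_ge0.
have w1 : w <= 1.
  by rewrite mulr_ile1 ?expR_ge0 // -expR0 ler_expR oppr_le0 divr_ge0 ?sqr_ge0.
rewrite normrM ger0_norm // (le_trans _ (equinode_expR_error n0 c0 s01 t01)) //.
by rewrite ler_piMl.
Qed.

(** * The tensor-product grid and the kernel residual *)

Lemma norm_prodB_le (R : realType) (d : nat) (A B : 'I_d -> R) (L e : R) :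
  1 <= L -> (forall l, `|A l| <= L) -> (forall l, `|B l| <= L) ->
  (forall l, `|A l - B l| <= e) ->
  `|\prod_(l < d) A l - \prod_(l < d) B l| <= d%:R * e * L ^+ d.
Proof.
move=> L1; have L0 : 0 <= L by lra.
elim: d A B => [|d IH] A B hA hB hAB.
  by rewrite !big_ord0 subrr normr0 !mul0r.
have e0 : 0 <= e by apply: le_trans (normr_ge0 _) (hAB ord0).
rewrite !big_ord_recr /=.
set P := \prod_(_ < d) _; set Q := \prod_(_ < d) _.
have hP : `|P - Q| <= d%:R * e * L ^+ d by apply: IH.
have hQ : `|Q| <= L ^+ d.
  rewrite normr_prod -[X in _ <= _ ^+ X]card_ord -prodr_const.
  by apply: ler_prod => l _; rewrite normr_ge0 /=.
(* Telescoping: the factors [A l] are replaced by [B l] one at a time. *)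
have -> : P * A ord_max - Q * B ord_max =
  (P - Q) * A ord_max + Q * (A ord_max - B ord_max) by ring.
rewrite (le_trans (ler_normD _ _)) // !normrM.
apply: (@le_trans _ _ (d%:R * e * L ^+ d * L + L ^+ d * L * e)).
  apply: lerD; first exact: ler_pM.
  apply: ler_pM => //; rewrite (le_trans hQ) // ler_peMr // exprn_ge0 //.
by rewrite exprS -[d.+1]addn1 natrD; rewrite le_eqVlt; apply/orP; left; apply/eqP; ring.
Qed.

Definition grid_point {R : realType} {d n : nat} (j : {ffun 'I_d -> 'I_n}) :
  'rV[R]_d := \row_l equinode n (j l).

Lemma grid_point_cube (R : realType) (d n : nat) (j : {ffun 'I_d -> 'I_n}) :
  unit_cube R d (grid_point j).
Proof. by move=> l; rewrite mxE equinode_itv. Qed.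

Definition grid_weight {R : realType} {d n : nat} (sigma : R) (x : 'rV[R]_d)
  (j : {ffun 'I_d -> 'I_n}) : R :=
  \prod_(l < d) interp_weight sigma (j l) (x ord0 l).

(** The variable is [y], placed last so that [grid_residual n sigma x] is k(., x) minus its
    approximation in the span of the grid sections. *)
Definition grid_residual {R : realType} {d : nat} (n : nat) (sigma : R)
  (x y : 'rV[R]_d) : R :=
  se_kernel sigma y x - \sum_(j : {ffun 'I_d -> 'I_n})
    grid_weight sigma x j * se_kernel sigma y (grid_point j).

Lemma grid_weight_sum_le (R : realType) (d n : nat) (sigma : R)
    (x : 'rV[R]_d) : unit_cube R d x ->
  \sum_(j : {ffun 'I_d -> 'I_n}) `|grid_weight sigma x j| <=
    (n%:R * (2 * expR 1) ^+ n * expR (sigma ^- 2)) ^+ d.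
Proof.
move=> hx; under eq_bigr do rewrite normr_prod.
rewrite -(bigA_distr_bigA (fun l i => `|interp_weight sigma i (x ord0 l)|)).
rewrite -[X in _ <= _ ^+ X]card_ord -prodr_const; apply: ler_prod => l _.
by rewrite interp_weight_sum_le // sumr_ge0.
Qed.

(** The kernel and its interpolant are both products over the coordinates, so [norm_prodB_le]
    reduces the claim to the one-dimensional error. *)
Lemma grid_residual_le (R : realType) (d n : nat) (sigma : R)
    (x y : 'rV[R]_d) : (0 < n)%N -> unit_cube R d x -> unit_cube R d y ->
  `|grid_residual n sigma x y| <=
  d%:R * ((1 + n%:R * (2 * expR 1) ^+ n) *
    ((2 / sigma ^+ 2) ^+ n / n`!%:R * expR (2 / sigma ^+ 2))) *
  (n%:R * (2 * expR 1) ^+ n * expR (sigma ^- 2)) ^+ d.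
Proof.
move=> n0 hx hy.
have -> : grid_residual n sigma x y =
    \prod_(l < d) se1 sigma (x ord0 l) (y ord0 l) -
    \prod_(l < d) \sum_(i < n) interp_weight sigma i (x ord0 l) *
      se1 sigma (equinode n i) (y ord0 l).
  rewrite /grid_residual se_kernelC se_kernelE bigA_distr_bigA /=.
  congr (_ - _); apply: eq_bigr => j _.
  rewrite se_kernelC se_kernelE -big_split /=; apply: eq_bigr => l _.
  by rewrite mxE.
have L1 : 1 <= n%:R * (2 * expR 1) ^+ n * expR (sigma ^- 2) :> R.
  rewrite -[leLHS]mul1r ler_pM //; last first.
    by rewrite -expR0 ler_expR invr_ge0 sqr_ge0.
  rewrite -[leLHS]mul1r ler_pM // ?ler1n // exprn_ege1 //.
  by have := expR_ge1Dx (1 : R); lra.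
apply: norm_prodB_le => // l.
- by rewrite ger0_norm ?expR_ge0 // (le_trans (se1_le1 _ _ _)).
- apply: le_trans (ler_norm_sum _ _ _) _.
  apply: le_trans (interp_weight_sum_le sigma n (hx l)).
  apply: ler_sum => i _; rewrite normrM ler_piMr //.
  by rewrite ger0_norm ?expR_ge0 // se1_le1.
- exact: se1_interp_error.
Qed.

(** By the reproducing property the left side is the squared norm of [grid_residual n sigma x],
    written here without the Hilbert space. The residual is of order C^n / n! and the weights grow
    at most geometrically, so the factorial wins. *)
Lemma grid_residual_bound (R : realType) (d : nat) (sigma : R) :
  exists N : nat, forall n, (N <= n)%N -> (0 < n)%N ->
    forall x : 'rV[R]_d, unit_cube R d x ->
    grid_residual n sigma x x - \sum_(j : {ffun 'I_d -> 'I_n})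
      grid_weight sigma x j * grid_residual n sigma x (grid_point j) <=
    (expR (- n%:R) / 6) ^+ 2.
Proof.
pose c : R := 2 / sigma ^+ 2; pose E : R := expR (sigma ^- 2) ^+ d.
have c0 : 0 <= c by rewrite divr_ge0 ?sqr_ge0.
have E1 : 1 <= E by rewrite exprn_ege1 // -expR0 ler_expR invr_ge0 sqr_ge0.
have e1 : 2 <= expR 1 :> R by have := expR_ge1Dx (1 : R); lra.
pose q : R := (4 * expR 1) ^+ d.
have q1 : 1 <= q by rewrite exprn_ege1 //; lra.
(* The 36 is the square of 6. One [q] comes from the residual bound, the other from the sum of the
   weights. The last [expR 1] upgrades exp(-n) to exp(-2n), as the bound is on a squared norm. *)
have [N hN] := geometric_le_fact_expR
  (36 * (d%:R * (2 * expR c) * E * (2 * E)))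
  ((4 * expR 1) * c * q * q * expR 1).
exists N => n Nn n0 x hx.
pose L : R := n%:R * (2 * expR 1) ^+ n * expR (sigma ^- 2).
pose B : R := d%:R * ((1 + n%:R * (2 * expR 1) ^+ n) *
  (c ^+ n / n`!%:R * expR c)) * L ^+ d.
have nle : n%:R * (2 * expR 1) ^+ n <= (4 * expR 1) ^+ n :> R.
  have -> : 4 * expR 1 = 2 * (2 * expR 1) :> R by ring.
  rewrite [in leRHS]exprMn ler_wpM2r ?exprn_ge0 ?mulr_ge0 ?expR_ge0 //.
  by rewrite -natrX ler_nat ltnW // ltn_expl.
have n1 : 1 <= n%:R * (2 * expR 1) ^+ n :> R.
  rewrite -[leLHS]mul1r ler_pM // ?ler1n // exprn_ege1 //; lra.
have Lle : L ^+ d <= q ^+ n * E.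
  by rewrite /L exprMn ler_wpM2r ?(le_trans _ E1) // /q exprAC lerXn2r ?nnegrE.
have LD0 : 0 <= L ^+ d.
  by rewrite exprn_ge0 // mulr_ge0 ?expR_ge0 // (le_trans _ n1).
have res y : unit_cube R d y -> `|grid_residual n sigma x y| <= B.
  exact: grid_residual_le.
have B0 : 0 <= B by apply: le_trans (normr_ge0 _) (res x hx).
apply: (@le_trans _ _ (B * (1 + L ^+ d))).
  rewrite mulrDr mulr1 lerD //; first exact: le_trans (ler_norm _) (res x hx).
  apply: le_trans (ler_norm _) _; rewrite normrN.
  apply: le_trans (ler_norm_sum _ _ _) _.
  apply: (@le_trans _ _ (\sum_(j : {ffun 'I_d -> 'I_n})
      `|grid_weight sigma x j| * B)).
    apply: ler_sum => j _; rewrite normrM ler_wpM2l //.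
    exact/res/grid_point_cube.
  by rewrite -mulr_suml mulrC ler_wpM2l // grid_weight_sum_le.
have f0 : 0 <= c ^+ n / n`!%:R * expR c.
  by rewrite !mulr_ge0 ?exprn_ge0 ?expR_ge0 ?invr_ge0 ?ler0n.
have Q1 : 1 <= q ^+ n by rewrite exprn_ege1.
apply: (@le_trans _ _ (d%:R * (2 * (4 * expR 1) ^+ n *
   (c ^+ n / n`!%:R * expR c)) * (q ^+ n * E) * (2 * (q ^+ n * E)))).
  apply: ler_pM => //; first by rewrite addr_ge0.
    apply: ler_pM => //; first by rewrite mulr_ge0 // mulr_ge0 //; lra.
    by rewrite ler_wpM2l // ler_wpM2r //; lra.
  have : 1 <= q ^+ n * E by rewrite -[leLHS]mul1r ler_pM.
  lra.
set X := leLHS.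
have {hN} : 36 * X * expR n%:R <= expR (- n%:R).
  move: (hN n Nn); congr (_ <= _).
  rewrite -[n%:R in RHS]mul1r expRM_natr /X !exprMn; ring.
have enn : expR n%:R * expR (- n%:R) = 1 :> R by rewrite expRxMexpNx_1.
move=> /(ler_wpM2r (expR_ge0 (- n%:R))); rewrite -[leLHS]mulrA enn mulr1 => h.
by rewrite exprMn exprVn expr2; lra.
Qed.

(** * Hilbert spaces of functions and reproducing kernels *)

Lemma fhs_sub (R : realType) (X : Type) (H : function_hilbert_space R X)
    (f g : X -> R) :
  fhs_carrier H f -> fhs_carrier H g -> fhs_carrier H (fun x => f x - g x).
Proof.
move=> hf hg; have := fhs_linear (-1) hg hf.
by congr fhs_carrier; apply/funext => x /=; rewrite mulN1r addrC.
Qed.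

Lemma inner_subl (R : realType) (X : Type) (H : function_hilbert_space R X)
    (f g h : X -> R) :
  fhs_carrier H f -> fhs_carrier H g -> fhs_carrier H h ->
  inner H (fun x => f x - g x) h = inner H f h - inner H g h.
Proof.
move=> hf hg hh; rewrite addrC -mulN1r -inner_linear //.
by congr inner; apply/funext => x /=; rewrite mulN1r addrC.
Qed.

Lemma inner0l (R : realType) (X : Type) (H : function_hilbert_space R X)
    (h : X -> R) : fhs_carrier H h -> inner H (fun=> 0) h = 0.
Proof.
move=> hh; have h0 := fhs_zero H.
rewrite -[RHS](subrr (inner H (fun=> 0) h)) -inner_subl //.
by congr inner; apply/funext => x; rewrite subrr.
Qed.

Lemma inner_subr (R : realType) (X : Type) (H : function_hilbert_space R X)
    (f g h : X -> R) :
  fhs_carrier H f -> fhs_carrier H g -> fhs_carrier H h ->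
  inner H h (fun x => f x - g x) = inner H h f - inner H h g.
Proof.
move=> hf hg hh; rewrite inner_sym ?inner_subl //; last exact: fhs_sub.
by rewrite (inner_sym hh hf) (inner_sym hh hg).
Qed.

Lemma fhs_sum (R : realType) (X : Type) (H : function_hilbert_space R X)
    (I : Type) (s : seq I) (c : I -> R) (g : I -> X -> R) :
  (forall i, fhs_carrier H (g i)) ->
  fhs_carrier H (fun x => \sum_(i <- s) c i * g i x).
Proof.
move=> hg; elim: s => [|i s IH].
  by have := fhs_zero H; congr fhs_carrier; apply/funext => x; rewrite big_nil.
have := fhs_linear (c i) (hg i) IH.
by congr fhs_carrier; apply/funext => x /=; rewrite big_cons.
Qed.

Lemma inner_suml (R : realType) (X : Type) (H : function_hilbert_space R X)
    (I : Type) (s : seq I) (c : I -> R) (g : I -> X -> R) (h : X -> R) :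
  (forall i, fhs_carrier H (g i)) -> fhs_carrier H h ->
  inner H (fun x => \sum_(i <- s) c i * g i x) h =
    \sum_(i <- s) c i * inner H (g i) h.
Proof.
move=> hg hh; elim: s => [|i s IH].
  rewrite big_nil -[RHS](inner0l hh); congr inner.
  by apply/funext => x; rewrite big_nil.
rewrite big_cons -IH -inner_linear //; last exact: fhs_sum.
by congr inner; apply/funext => x /=; rewrite big_cons.
Qed.

Lemma fhs_cauchy_schwarz (R : realType) (X : Type)
    (H : function_hilbert_space R X) (f g : X -> R) :
  fhs_carrier H f -> fhs_carrier H g ->
  inner H f g ^+ 2 <= inner H f f * inner H g g.
Proof.
move=> hf hg.
have quad (a : R) :
    0 <= a ^+ 2 * inner H f f + 2 * a * inner H f g + inner H g g.
  have hc := fhs_linear a hf hg.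
  have := inner_ge0 hc; rewrite inner_linear //.
  rewrite (inner_sym hf hc) (inner_sym hg hc) !inner_linear //.
  by rewrite (inner_sym hg hf); lra.
have f0 := inner_ge0 hf; have g0 := inner_ge0 hg.
have [fE|fN] := eqVneq (inner H f f) 0.
  (* [quad] is then affine in [a], and takes the value -1 unless its slope is 0. *)
  have fgE : inner H f g = 0.
    have := quad (- (inner H g g + 1) / (2 * inner H f g)).
    rewrite fE mulr0 add0r; have [//|fgN] := eqVneq (inner H f g) 0.
    have -> : 2 * (- (inner H g g + 1) / (2 * inner H f g)) * inner H f g =
      - (inner H g g + 1) by field.
    lra.
  by rewrite fgE fE expr0n mul0r.
have fpos : 0 < inner H f f by rewrite lt_neqAle eq_sym fN.
have := quad (- inner H f g / inner H f f).
have -> : (- inner H f g / inner H f f) ^+ 2 * inner H f f +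
   2 * (- inner H f g / inner H f f) * inner H f g + inner H g g =
   (inner H f f * inner H g g - inner H f g ^+ 2) / inner H f f by field.
by rewrite pmulr_lge0 ?invr_gt0 // subr_ge0.
Qed.

Lemma hball_inner (R : realType) (X : Type) (H : function_hilbert_space R X)
    (r : R) (f : X -> R) : 0 <= r -> fhs_carrier H f ->
  hball H r f <-> inner H f f <= r ^+ 2.
Proof.
move=> r0 hf; rewrite /hball /= /hnorm -(ler_sqrt _ (sqr_ge0 r)) sqrtr_sqr.
by rewrite ger0_norm //; split => [[]|].
Qed.

(** Applied to two functions with the same samples: their difference vanishes on the grid and has
    norm at most 2r. *)
Lemma hball_sub (R : realType) (X : Type) (H : function_hilbert_space R X)
    (r : R) (f g : X -> R) : 0 <= r -> hball H r f -> hball H r g ->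
  inner H (fun x => f x - g x) (fun x => f x - g x) <= (2 * r) ^+ 2.
Proof.
move=> r0 bf bg; have [hf _] := bf; have [hg _] := bg.
move/(hball_inner r0 hf): bf; move/(hball_inner r0 hg): bg.
have := fhs_cauchy_schwarz hf hg.
rewrite inner_subl //; last exact: fhs_sub.
rewrite !inner_subr // (inner_sym hg hf).
have f0 := inner_ge0 hf; have g0 := inner_ge0 hg.
move: (inner H f g) (inner H f f) (inner H g g) f0 g0 => a b c b0 c0 cs lc lb.
have : `|a| <= r ^+ 2.
  rewrite -ler_sqr ?nnegrE ?exprn_ge0 // real_normK ?num_real //.
  by apply: le_trans cs _; rewrite expr2 ler_pM.
rewrite ler_norml => /andP[la _]; lra.
Qed.

(** Cauchy-Schwarz against the kernel section at [x]. It supplies the lower bounds on ranges that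
    make the infimum in the regret meaningful. *)
Lemma rkhs_bounded (R : realType) (X : Type) (H : function_hilbert_space R X)
    (k : X -> X -> R) (r : R) (f : X -> R) (x : X) :
  is_rkhs_of H k -> k x x <= 1 -> 0 <= r -> hball H r f -> `|f x| <= r.
Proof.
move=> hk k1 r0 bf; have [hf _] := bf; have [hkx hE] := hk x.
move/(hball_inner r0 hf): bf => fr.
rewrite -ler_sqr ?nnegrE // real_normK ?num_real // hE //.
apply: le_trans (fhs_cauchy_schwarz hf hkx) _.
rewrite -(hE _ hkx) -[leRHS]mulr1 ler_pM ?inner_ge0 //.
by rewrite (hE _ hkx) inner_ge0.
Qed.

(** Pairing [g] with the residual at [x] gives g(x) minus a combination of grid values, that is g(x)
    itself. Cauchy-Schwarz and the norm of the residual conclude. *)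
Lemma se_vanishing_le (R : realType) (d : nat) (sigma : R) :
  exists N : nat, forall n, (N <= n)%N -> (0 < n)%N ->
    forall (H : function_hilbert_space R 'rV[R]_d) (g : 'rV[R]_d -> R) (r : R),
    is_rkhs_of H (se_kernel sigma) -> 0 <= r ->
    fhs_carrier H g -> inner H g g <= r ^+ 2 ->
    (forall j : {ffun 'I_d -> 'I_n}, g (grid_point j) = 0) ->
    forall x, unit_cube R d x -> `|g x| <= r * (expR (- n%:R) / 6).
Proof.
have [N hN] := grid_residual_bound d sigma; exists N => n Nn n0.
move=> H g r hk r0 hg gr gz x hx.
pose comb y := \sum_(j : {ffun 'I_d -> 'I_n})
  grid_weight sigma x j * se_kernel sigma y (grid_point j).
have hkz z := (hk z).1.
have hcomb : fhs_carrier H comb by apply: fhs_sum => j; apply: hkz.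
have hrho : fhs_carrier H (grid_residual n sigma x) by apply: fhs_sub.
have rhoE h : fhs_carrier H h -> inner H (grid_residual n sigma x) h =
    h x - \sum_(j : {ffun 'I_d -> 'I_n}) grid_weight sigma x j * h (grid_point j).
  move=> hh; rewrite inner_subl // inner_suml //.
  rewrite (inner_sym (hkz x) hh) -(hk x).2 //; congr (_ - _).
  by apply: eq_bigr => j _; rewrite (inner_sym (hkz _) hh) -(hk _).2.
have gE : inner H (grid_residual n sigma x) g = g x.
  by rewrite rhoE // big1 ?subr0 // => j _; rewrite gz mulr0.
have e0 : 0 <= expR (- n%:R) / 6 :> R by rewrite divr_ge0 ?expR_ge0.
rewrite -ler_sqr ?nnegrE ?mulr_ge0 // real_normK ?num_real // -gE.
apply: le_trans (fhs_cauchy_schwarz hrho hg) _.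
rewrite exprMn mulrC ler_pM ?inner_ge0 // rhoE //.
exact: hN.
Qed.

(** * The sampling algorithm and the upper bound *)

Lemma historyE (R : realType) (X : Type) (pi : det_algorithm R X) (f : X -> R)
    (t : nat) :
  tval (history pi f t) = [seq (query pi f i, f (query pi f i)) | i <- iota 0 t].
Proof.
elim: t => // t IH; rewrite -[t.+1]addn1 iotaD map_cat /= add0n cats1 -IH.
by rewrite addn1.
Qed.

(** Minimality up to [e] makes existence follow from the definition of the infimum alone, without
    continuity or compactness. *)
Definition argmin_consistent {R : realType} {X : Type} (S : set (X -> R))
    (e : R) (h : seq (X * R)) : set X :=
  [set x | exists g, [/\ S g, [seq g p.1 | p <- h] = [seq p.2 | p <- h] &
                       forall y, g x <= g y + e]].

(** The final [z 0] is a default for histories with no candidate; [sample_then_minimize_regret]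
    shows that it is not reached at time [N] on its target functions. *)
Definition sample_then_minimize {R : realType} {X : Type} (S : set (X -> R))
    (e : R) (z : nat -> X) (N : nat) : det_algorithm R X := fun t h =>
  if (t < N)%N then z t else
  if pselect (exists x, argmin_consistent S e h x) is left ex
  then projT1 (cid ex) else z 0.

(** A candidate exists because [f] is consistent with its own samples. If x is the last query and g
    its witness, then f(x) <= g(x) + e <= g(y) + 2e <= f(y) + 3e for all y. *)
Lemma sample_then_minimize_regret (R : realType) (X : Type) (S : set (X -> R))
    (e : R) (z : nat -> X) (N : nat) (f : X -> R) :
  0 < e -> S f -> has_lbound (range f) ->
  (forall g, S g -> (forall i, (i < N)%N -> g (z i) = f (z i)) ->
    forall x, `|g x - f x| <= e) ->
  simple_regret (sample_then_minimize S e z N) f N.+1 <= 3 * e.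
Proof.
move=> e0 Sf fb hfg; set pi := sample_then_minimize S e z N.
have qz i : (i < N)%N -> query pi f i = z i.
  by move=> iN; rewrite /query /pi /sample_then_minimize iN.
have : argmin_consistent S e (history pi f N) (query pi f N).
  rewrite /query {2}/pi /sample_then_minimize ltnn.
  case: pselect => [ex|[]]; first exact: projT2 (cid ex).
  have [|_ [x _ <-] hx] := @inf_adherent _ (range f) e e0.
    by split=> //; exists (f (z 0)), (z 0).
  exists x, f; split=> //.
    by rewrite historyE -!map_comp; apply: eq_map.
  move=> y; apply/ltW/(lt_le_trans hx); rewrite lerD2r.
  by apply: ge_inf => //; exists y.
case=> g [Sg]; rewrite historyE -!map_comp => /eq_in_map gz gmin.
have gf x : `|g x - f x| <= e.
  apply: hfg => // i iN; have := gz i; rewrite mem_iota /= add0n => /(_ iN).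
  by rewrite qz.
rewrite /simple_regret.
apply: (@le_trans _ _ (f (query pi f N) - inf (range f))).
  by rewrite lerD2r; apply: (bigmin_le _ (ord_max : 'I_N.+1)).
suff : f (query pi f N) - 3 * e <= inf (range f) by lra.
apply: lb_le_inf; first by exists (f (z 0)), (z 0).
move=> _ [y _ <-]; have := gmin y; have := gf y; have := gf (query pi f N).
by rewrite !ler_norml => /andP[] ? ? /andP[] ? ?; lra.
Qed.

Lemma se_upper_bound (R : realType) (d : nat) (sigma : R) :
  exists N : nat, forall n, (N <= n)%N -> (0 < n)%N ->
  forall (H : function_hilbert_space R 'rV[R]_d) (rad : R),
    is_rkhs_of H (se_kernel sigma) -> 0 < rad ->
    exists pi : det_algorithm R (unit_cube R d),
      achieves_regret pi (hball H rad) (n ^ d).+1 (rad * expR (- n%:R)).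
Proof.
have [N hN] := se_vanishing_le d sigma; exists N => n Nn n0 H rad hk rad0.
have card : #|{: {ffun 'I_d -> 'I_n}}| = (n ^ d)%N.
  by rewrite card_ffun !card_ord.
pose j0 : {ffun 'I_d -> 'I_n} := [ffun=> Ordinal n0].
pose j i := nth j0 (enum {: {ffun 'I_d -> 'I_n}}) i.
pose z i : unit_cube R d := SigSub (mem_set (@grid_point_cube R d n (j i))).
pose e := rad * expR (- n%:R) / 3.
(* The ball restricted to the cube, where the algorithm lives. *)
pose S : set (unit_cube R d -> R) :=
  [set g | exists2 f, hball H rad f & g = fun x => f (val x)].
exists (sample_then_minimize S e z (n ^ d)) => f bf.
have -> : rad * expR (- n%:R) = 3 * e by rewrite /e; field.
have rad0' := ltW rad0.
apply: sample_then_minimize_regret.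
- by rewrite /e !mulr_gt0 ?expR_gt0 ?invr_gt0.
- by exists f.
- exists (- rad) => _ [x _ <-]; rewrite lerNl.
  apply: le_trans (ler_norm _) _; rewrite normrN.
  apply: (rkhs_bounded hk) => //; exact: se_kernel_le1.
move=> _ [g bg ->] gf x.
have [hf _] := bf; have [hg _] := bg.
(* The 6 is 2 times 3: the difference of two ball members has norm up to 2 [rad], and the regret
   costs 3 [e]. *)
have -> : e = 2 * rad * (expR (- n%:R) / 6) by rewrite /e; field.
apply: (hN n Nn n0 H (fun y => g y - f y)) => //.
- by rewrite mulr_ge0.
- exact: fhs_sub.
- exact: hball_sub.
- move=> i; have iN : (index i (enum {: {ffun 'I_d -> 'I_n}}) < n ^ d)%N.
    by rewrite -card cardE index_mem mem_enum.
  have := gf _ iN; rewrite /z /= /j nth_index ?mem_enum // => ->.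
  by rewrite subrr.
- exact: set_mem (valP x).
Qed.

(** * Inverse of the Gram matrix of the grid *)

Lemma coef_prod_XsubC_le (R : realType) (I : Type) (r : seq I) (P : pred I)
    (u : I -> R) (k : nat) :
  `|(\prod_(i <- r | P i) ('X - (u i)%:P))`_k| <=
    \prod_(i <- r | P i) (1 + `|u i|).
Proof.
elim: r k => [|i r IH] k.
  by rewrite !big_nil coef1; case: k => [|k]; rewrite /= ?normr1 ?normr0.
rewrite !big_cons; case: ifP => // _.
set p := \prod_(_ <- _ | _) _ in IH *; set q := \prod_(_ <- _ | _) _ in IH *.
have q0 : 0 <= q by apply: le_trans (normr_ge0 _) (IH 0).
rewrite mulrBl coefB coefXM coefCM mulrDl mul1r.
rewrite (le_trans (ler_normB _ _)) // lerD //; last by rewrite normrM ler_wpM2l.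
by case: k => [|k] /=; rewrite ?normr0.
Qed.

(** Consecutive powers are q^i (q - 1) apart, and q^i >= 1. *)
Lemma geometric_gap (R : realType) (q : R) (i j : nat) : 1 <= q -> i != j ->
  q - 1 <= `|q ^+ i - q ^+ j|.
Proof.
move=> q1; wlog ij : i j / (i < j)%N => [hw|_].
  rewrite neq_ltn => /orP[] ij; last rewrite distrC; apply: hw => //.
    by rewrite ltn_eqF.
  by rewrite ltn_eqF.
rewrite distrC; apply: le_trans (ler_norm _).
have qi : 1 <= q ^+ i by rewrite exprn_ege1.
have : q ^+ i.+1 <= q ^+ j by rewrite ler_weXn2l.
rewrite exprS => h.
have : 0 <= (q - 1) * (q ^+ i - 1) by rewrite mulr_ge0 //; lra.
lra.
Qed.

(** Each of the n - 1 factors has coefficients controlled by 1 + q^m and a denominator of at least q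
    - 1. *)
Lemma lagrange_geometric_coef_le (R : realType) (n : nat) (q : R) (i : 'I_n)
    (k : nat) : 1 < q ->
  `|(tnth (n.-lagrange (fun m => q ^+ m)) i : {poly R})`_k| <=
    ((1 + q ^+ n) * (1 + (q - 1)^-1)) ^+ n.
Proof.
move=> q1; have n0 : (0 < n)%N by apply: leq_trans (ltn_ord i).
have qinj : injective (fun m => q ^+ m) by apply: ieexprIn; lra.
rewrite lagrangeE //= coefCM horner_prod normrM normfV normr_prod.
apply: (@le_trans _ _ ((\prod_(m < n | m != i) `|('X - (q ^+ m)%:P).[q ^+ i]|)^-1
   * \prod_(m < n | m != i) (1 + `|q ^+ m|))).
  by rewrite ler_wpM2l ?coef_prod_XsubC_le // invr_ge0 prodr_ge0.
rewrite -prodfV -big_split /=.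
(* Adding 1 to the inverse gap makes the base at least 1, so the exponent n - 1 can be raised to
   n. *)
have K1 : 1 <= (1 + q ^+ n) * (1 + (q - 1)^-1).
  have : 0 <= q ^+ n by rewrite exprn_ge0; lra.
  have : 0 <= (q - 1)^-1 by rewrite invr_ge0; lra.
  by move=> a b; have := mulr_ge0 a b; lra.
apply: (@le_trans _ _ (\prod_(m < n | m != i)
    ((1 + q ^+ n) * (1 + (q - 1)^-1)))); last first.
  rewrite prodr_const ler_weXn2l // cardC1 card_ord; exact: leq_pred.
apply: ler_prod => m mi; apply/andP; split.
  by rewrite mulr_ge0 ?invr_ge0 ?addr_ge0.
have gap := geometric_gap (ltW q1) (_ : (i : nat) != m).
rewrite hornerXsubC mulrC ler_pM ?invr_ge0 ?addr_ge0 //.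
  rewrite lerD2l ger0_norm ?exprn_ge0 //; last by lra.
  by rewrite ler_weXn2l //; [lra | apply/ltnW].
apply: (@le_trans _ _ (q - 1)^-1); last by lra.
by rewrite lef_pV2 ?posrE ?gap 1?eq_sym // ?(lt_le_trans _ (gap _)) 1?eq_sym //; lra.
Qed.

(** On the grid the last factor of [se1E] is (q^m)^j, so summing it against the coefficients of a
    Lagrange basis polynomial evaluates that polynomial at the node q^m. Dividing by the Gaussian
    weights gives the inverse. *)
Lemma se1_gram_inverse (R : realType) (sigma : R) : 0 < sigma ->
  exists2 b : R, 0 < b & forall n, (0 < n)%N -> exists B : 'I_n -> 'I_n -> R,
    (forall i m : 'I_n,
       \sum_(j < n) B i j * se1 sigma (equinode n j) (equinode n m) =
       (i == m)%:R) /\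
    (forall i j, `|B i j| <= expR (b * n%:R ^+ 2)).
Proof.
move=> sigma0; pose c : R := 2 / sigma ^+ 2.
have c0 : 0 < c by rewrite divr_gt0 ?exprn_gt0.
have ci : 0 < c^-1 by rewrite invr_gt0.
(* The first term pays for the two inverse weights, the rest for the n-th power bounding the
   Lagrange coefficients. *)
exists (2 / sigma ^+ 2 + 3 + c + c^-1); first by rewrite -/c; lra.
move=> n n0; have nR : 1 <= n%:R :> R by rewrite ler1n.
have n2 : 1 <= n%:R ^+ 2 :> R by rewrite exprn_ege1.
have nN : n%:R != 0 :> R by rewrite gt_eqF //; lra.
pose q : R := expR (c / n%:R ^+ 2).
have q1 : 1 < q by rewrite expR_gt1 divr_gt0 //; lra.
have qinj : injective (fun m => q ^+ m) by apply: ieexprIn; lra.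
pose w (i : 'I_n) : R := expR (- (equinode n i ^+ 2 / sigma ^+ 2)).
have w0 i : w i != 0 by rewrite gt_eqF ?expR_gt0.
pose L i : {poly R} := tnth (n.-lagrange (fun m => q ^+ m)) i.
exists (fun i j : 'I_n => (L i)`_j / (w i * w j)); split=> [i m|i j].
  have -> : (i == m)%:R = w m / w i * (L i).[q ^+ m].
    rewrite /L (lagrange_sample n0 qinj).
    by case: eqP => [->|_]; rewrite ?mulr0 // mulr1 divff.
  rewrite (@horner_coef_wide _ n) ?size_lagrange_ // mulr_sumr.
  apply: eq_bigr => j _; rewrite se1E -/(w _) -/(w _).
  have -> : expR (2 / sigma ^+ 2 * equinode n j * equinode n m) = (q ^+ m) ^+ j.
    rewrite -exprM -expRM_natr -/c; congr expR; rewrite /equinode natrM.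
    by field.
  by field; rewrite !w0.
have wV i' : (w i')^-1 <= expR (sigma ^- 2).
  rewrite -expRN opprK ler_expR -[leRHS]mul1r ler_wpM2r ?invr_ge0 ?sqr_ge0 //.
  by have /andP[? ?] := equinode_itv R i'; rewrite expr_le1.
have qn : q ^+ n <= expR c.
  rewrite -expRM_natr ler_expR expr2 invfM mulrA mulfVK //.
  by rewrite ler_pdivrMr ?ler_peMr //; lra.
(* n^2 is absorbed into exp(2 n) so that the n-th power below stays exp(O(n^2)). *)
have qV : 1 + (q - 1)^-1 <= expR (c^-1 + 2 * n%:R).
  have := expR_ge1Dx (c / n%:R ^+ 2); rewrite -/q => qc.
  have : (q - 1)^-1 <= n%:R ^+ 2 / c.
    have n2' : 0 < n%:R ^+ 2 :> R by lra.
    rewrite -[leRHS]invf_div lef_pV2 ?posrE ?(divr_gt0 c0 n2') //; lra.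
  have := expR_ge1Dx c^-1; have := expR_ge1Dx (n%:R : R).
  rewrite expRD (expRM_natl 2 (n%:R : R)) => h1 h2 h3.
  have h4 : n%:R ^+ 2 <= expR n%:R ^+ 2 :> R.
    by rewrite ler_sqr ?nnegrE ?expR_ge0 //; lra.
  apply: (@le_trans _ _ ((1 + c^-1) * n%:R ^+ 2)); first by lra.
  by rewrite ler_pM //; lra.
have K : (1 + q ^+ n) * (1 + (q - 1)^-1) <= expR ((3 + c + c^-1) * n%:R).
  apply: (@le_trans _ _ (expR (1 + c) * expR (c^-1 + 2 * n%:R))).
    apply: ler_pM => //.
    - by rewrite addr_ge0 // exprn_ge0; lra.
    - by rewrite addr_ge0 // invr_ge0; lra.
    rewrite expRD; have := expR_ge1Dx c; have := expR_ge1Dx (1 : R) => h1 h2.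
    apply: (@le_trans _ _ (2 * expR c)); first by lra.
    by rewrite ler_wpM2r ?expR_ge0 //; lra.
  rewrite -expRD ler_expR.
  have : 0 <= (1 + c + c^-1) * (n%:R - 1) by rewrite mulr_ge0 //; lra.
  lra.
have wE i' : `|w i'| = w i' by rewrite ger0_norm ?expR_ge0.
rewrite normrM normfV normrM !wE invfM.
apply: (@le_trans _ _ (expR ((3 + c + c^-1) * n%:R ^+ 2) *
   (expR (sigma ^- 2) * expR (sigma ^- 2)))).
  apply: ler_pM => //.
  - by rewrite mulr_ge0 // invr_ge0 expR_ge0.
  - apply: le_trans (lagrange_geometric_coef_le _ _ q1) _.
    rewrite [X in expR X](_ : _ = (3 + c + c^-1) * n%:R * n%:R); last by ring.
    rewrite expRM_natr lerXn2r ?nnegrE ?expR_ge0 //.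
    rewrite mulr_ge0 // addr_ge0 ?invr_ge0 ?exprn_ge0 //; lra.
  - by rewrite ler_pM ?invr_ge0 ?expR_ge0.
rewrite -!expRD ler_expR.
have : sigma ^- 2 * (n%:R ^+ 2 - 1) >= 0 :> R.
  by rewrite mulr_ge0 ?invr_ge0 ?sqr_ge0 //; lra.
lra.
Qed.

(** The tensor power of [B] inverts the Gram matrix of the whole grid, so [v i] is a sum of n^d grid
    values with weights at most beta^d. *)
Lemma se_gram_coef_le (R : realType) (d n : nat) (sigma beta M : R)
    (B : 'I_n -> 'I_n -> R) (v : {ffun 'I_d -> 'I_n} -> R)
    (i : {ffun 'I_d -> 'I_n}) :
  (forall i m : 'I_n,
     \sum_(j < n) B i j * se1 sigma (equinode n j) (equinode n m) =
     (i == m)%:R) ->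
  (forall i j, `|B i j| <= beta) ->
  (forall j : {ffun 'I_d -> 'I_n}, `|\sum_(m : {ffun 'I_d -> 'I_n})
     v m * se_kernel sigma (grid_point j) (grid_point m)| <= M) ->
  `|v i| <= (n ^ d)%:R * beta ^+ d * M.
Proof.
move=> hB hb hM.
set f := fun j : {ffun 'I_d -> 'I_n} => \sum_(m : {ffun 'I_d -> 'I_n})
  v m * se_kernel sigma (grid_point j) (grid_point m).
have -> : v i = \sum_(j : {ffun 'I_d -> 'I_n}) (\prod_(l < d) B (i l) (j l)) * f j.
  under eq_bigr do rewrite mulr_sumr.
  rewrite exchange_big /= (bigD1 i) //= [X in _ + X]big1 => [|m mi].
    rewrite addr0 -[LHS]mulr1.
    transitivity (v i * \prod_(l < d) \sum_(j < n)
        B (i l) j * se1 sigma (equinode n j) (equinode n (i l))).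
      by congr (_ * _); rewrite big1 // => l _; rewrite hB eqxx.
    rewrite bigA_distr_bigA mulr_sumr; apply: eq_bigr => j _.
    rewrite se_kernelE big_split /= mulrCA; congr (_ * (_ * _)).
    by apply: eq_bigr => l _; rewrite !mxE.
  transitivity (v m * \prod_(l < d) \sum_(j < n)
      B (i l) j * se1 sigma (equinode n j) (equinode n (m l))).
    rewrite bigA_distr_bigA mulr_sumr; apply: eq_bigr => j _.
    rewrite se_kernelE big_split /= mulrCA; congr (_ * (_ * _)).
    by apply: eq_bigr => l _; rewrite !mxE.
  (* Distinct multi-indices differ in some coordinate, whose factor is 0. *)
  have [l ml] : exists l, i l != m l.
    apply/existsP; apply: contraNT mi; rewrite negb_exists => /forallP h.
    by apply/eqP/ffunP => l; have := h l; rewrite negbK => /eqP.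
  by rewrite (bigD1 l) //= hB (negbTE ml) mul0r mulr0.
apply: le_trans (ler_norm_sum _ _ _) _.
apply: (@le_trans _ _ (\sum_(j : {ffun 'I_d -> 'I_n}) beta ^+ d * M)).
  apply: ler_sum => j _; rewrite normrM ler_pM ?hM // normr_prod.
  rewrite -[X in _ <= _ ^+ X]card_ord -prodr_const.
  by apply: ler_prod => l _; rewrite normr_ge0 hb.
by rewrite sumr_const card_ffun !card_ord -mulrA [leRHS]mulr_natl.
Qed.

(** * The adversary and the lower bound *)

Lemma exists_annihilating_weights (F : fieldType) (J : finType) (T : nat)
    (a : J -> 'I_T -> F) : (T < #|J|)%N ->
  exists v : J -> F, (exists j, v j != 0) /\
    forall t, \sum_j v j * a j t = 0.
Proof.
move=> TJ; pose A := \matrix_(j < #|J|, t < T) a (enum_val j) t.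
(* The rank is at most the number [T] of columns, fewer than the rows, so the left kernel is
   nontrivial. *)
have : kermx A != 0.
  rewrite kermx_eq0 /row_free; apply: contraL TJ => /eqP <-.
  by rewrite -leqNgt rank_leq_col.
move=> /rowV0Pn[r /sub_kermxP rA r0].
exists (fun j => r ord0 (enum_rank j)); split.
  have /rV0Pn[k rk] := r0.
  by exists (enum_val k); rewrite enum_valK.
move=> t; have := congr1 (fun B : 'rV_T => B ord0 t) rA; rewrite !mxE => rt.
rewrite -[RHS]rt.
rewrite (reindex (@enum_val J predT)) /=; last exact/onW_bij/enum_val_bij.
by apply: eq_bigr => k _; rewrite enum_valK mxE.
Qed.

(** The algorithm sees only zeros, hence cannot distinguish [g] from the zero function. *)
Lemma history_vanishing (R : realType) (X : Type) (pi : det_algorithm R X)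
    (g : X -> R) (T t : nat) :
  (forall i, (i < T)%N -> g (query pi (fun=> 0) i) = 0) -> (t <= T)%N ->
  history pi g t = history pi (fun=> 0) t.
Proof.
move=> hg; elim: t => // t IH tT /=.
rewrite IH ?(ltnW tT) //.
by have := hg t tT; rewrite /query => ->.
Qed.

Lemma vanishing_regret_ge (R : realType) (X : Type) (pi : det_algorithm R X)
    (g : X -> R) (T : nat) (x : X) : (0 < T)%N -> has_lbound (range g) ->
  (forall i, (i < T)%N -> g (query pi (fun=> 0) i) = 0) ->
  - g x <= simple_regret pi g T.
Proof.
move=> T0 gb hg.
have hq i : (i < T)%N -> g (query pi g i) = 0.
  by move=> iT; rewrite /query (history_vanishing hg (ltnW iT)) hg.
have : inf (range g) <= g x by apply: ge_inf => //; exists x.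
have : 0 <= \big[Num.min/g (query pi g 0)]_(t < T) g (query pi g t).
  by apply: le_bigmin => [|i _]; rewrite hq.
rewrite /simple_regret; lra.
Qed.

(** With M the largest value of |f| on the grid, the squared norm of f is the sum of [v j] times f
    at the grid points, hence at most A M^2. Scaled into the ball, f still reaches depth rad /
    sqrt(A) at a grid point while every query returns 0. *)
Lemma se_regret_ge (R : realType) (d : nat) (sigma : R) : 0 < sigma ->
  exists2 b : R, 0 < b & forall n, (0 < n)%N ->
  forall (H : function_hilbert_space R 'rV[R]_d) (rad eps : R) (T : nat)
    (pi : det_algorithm R (unit_cube R d)),
    is_rkhs_of H (se_kernel sigma) -> 0 < rad -> (0 < T < n ^ d)%N ->
    achieves_regret pi (hball H rad) T eps ->
    rad * expR (- (b * n%:R ^+ 2)) <= eps.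
Proof.
move=> sigma0; have [b b0 hb] := se1_gram_inverse sigma0.
(* Dominates the exponent of sqrt(A); the last 1 keeps the constant positive even for d = 0. *)
exists (d%:R * (1 + b) + 1).
  by rewrite ltr_wpDl // mulr_ge0 //; lra.
move=> n n0 H rad eps T pi hk rad0 /andP[T0 TN] hpi.
have [B [hB hBb]] := hb n n0.
pose J : finType := {ffun 'I_d -> 'I_n}.
have cardJ : #|J| = (n ^ d)%N by rewrite card_ffun !card_ord.
pose N : R := (n ^ d)%:R.
pose beta : R := expR (b * n%:R ^+ 2).
have TJ : (T < #|J|)%N by rewrite cardJ.
have [v [[j0 vj0] hv]] := exists_annihilating_weights
  (fun (j : J) (t : 'I_T) =>
     se_kernel sigma (val (query pi (fun=> 0) t)) (grid_point j)) TJ.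
pose f y := \sum_(j : J) v j * se_kernel sigma y (grid_point j).
have [js _ hjs] := arg_maxP (fun j : J => `|f (grid_point j)|) (isT : xpredT j0).
pose M := `|f (grid_point js)|.
have hM (j : J) : `|f (grid_point j)| <= M by apply: hjs.
have vle (j : J) : `|v j| <= N * beta ^+ d * M.
  exact: (@se_gram_coef_le R d n sigma beta M B v j hB hBb hM).
have N1 : 1 <= N by rewrite ler1n expn_gt0 n0.
have be0 : 0 < beta ^+ d by rewrite exprn_gt0 // expR_gt0.
(* Invertibility of the Gram matrix: nonzero weights cannot give a function vanishing on the whole
   grid. *)
have M0 : 0 < M.
  rewrite lt_neqAle normr_ge0 andbT; apply: contraNneq vj0 => Me.
  by rewrite -normr_le0 (le_trans (vle j0)) // -Me mulr0.
pose A := N ^+ 2 * beta ^+ d.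
have A0 : 0 < A by rewrite mulr_gt0 // exprn_gt0 //; lra.
have fE (h : 'rV[R]_d -> R) : fhs_carrier H h ->
    inner H f h = \sum_(j : J) v j * h (grid_point j).
  move=> hh; rewrite inner_suml // => [|j]; last exact: (hk _).1.
  apply: eq_bigr => j _.
  by rewrite (inner_sym (hk _).1 hh) -(hk _).2.
have hf : fhs_carrier H f by apply: fhs_sum => j; apply: (hk _).1.
have ff : inner H f f <= A * M ^+ 2.
  rewrite fE // (le_trans (ler_norm _)) // (le_trans (ler_norm_sum _ _ _)) //.
  apply: (@le_trans _ _ (\sum_(j : J) N * beta ^+ d * M * M)).
    by apply: ler_sum => j _; rewrite normrM ler_pM.
  rewrite sumr_const cardJ -mulr_natl -/N /A.
  by rewrite le_eqVlt; apply/orP; left; apply/eqP; ring.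
pose s := Num.sqrt A; have s0 : 0 < s by rewrite sqrtr_gt0.
have sA : s ^+ 2 = A by rewrite sqr_sqrtr // ltW.
(* The sign makes [g] negative at the maximising grid point; the scale brings its norm down to at
   most [rad]. *)
pose a := - Num.sg (f (grid_point js)) * (rad / (s * M)).
pose g y := a * f y + 0.
have hg : fhs_carrier H g := fhs_linear a hf (fhs_zero H).
have sg2 : Num.sg (f (grid_point js)) ^+ 2 = 1.
  by rewrite sqr_sg -normr_gt0 M0.
have bg : hball H rad g.
  apply/(hball_inner (ltW rad0) hg).
  have h0 := fhs_zero H.
  rewrite inner_linear // (inner_sym hf hg) inner_linear // (inner0l hg).
  rewrite (inner0l hf) !addr0 mulrA -expr2.
  have -> : a ^+ 2 = rad ^+ 2 / (A * M ^+ 2).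
    by rewrite /a -sA !exprMn sqrrN sg2 mul1r exprVn exprMn.
  have AM0 : 0 < A * M ^+ 2 by rewrite mulr_gt0 ?exprn_gt0.
  by rewrite mulrAC ler_pdivrMr // ler_wpM2l ?sqr_ge0.
pose x : unit_cube R d := SigSub (mem_set (@grid_point_cube R d n js)).
have glb : has_lbound (range (fun y : unit_cube R d => g (val y))).
  exists (- rad) => _ [y _ <-]; rewrite lerNl.
  apply: le_trans (ler_norm _) _; rewrite normrN.
  by apply: (rkhs_bounded hk) => //; [exact: se_kernel_le1 | exact: ltW].
have gz i : (i < T)%N -> g (val (query pi (fun=> 0) i)) = 0.
  move=> iT; rewrite /g addr0 [f _](hv (Ordinal iT)) mulr0 //.
have := le_trans (vanishing_regret_ge x T0 glb gz) (hpi _ bg).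
have -> : - g (val x) = rad / s.
  rewrite /g /a addr0 !mulNr opprK mulrAC -normrEsg -/M.
  by field; rewrite !gt_eqF.
apply: le_trans; rewrite ler_wpM2l ?(ltW rad0) // expRN.
rewrite lef_pV2 ?posrE ?expR_gt0 //.
rewrite -ler_sqr ?nnegrE ?expR_ge0 ?(ltW s0) // sA -expRM_natr.
have nR : 1 <= n%:R :> R by rewrite ler1n.
have NE : N <= expR (d%:R * n%:R ^+ 2).
  rewrite /N natrX expRM_natl lerXn2r ?nnegrE ?expR_ge0 //.
  apply: (@le_trans _ _ (1 + n%:R ^+ 2)); last exact: expR_ge1Dx.
  have : 0 <= n%:R * (n%:R - 1) :> R by rewrite mulr_ge0 //; lra.
  lra.
apply: (@le_trans _ _ (expR (d%:R * n%:R ^+ 2) ^+ 2 * beta ^+ d)).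
  by rewrite ler_wpM2r ?(ltW be0) // lerXn2r ?nnegrE ?expR_ge0 //; lra.
rewrite -!expRM_natr -expRD ler_expR.
have : 0 <= d%:R * b * n%:R ^+ 2 by rewrite !mulr_ge0 ?exprn_ge0 //; lra.
have : 0 <= n%:R ^+ 2 :> R by rewrite exprn_ge0.
lra.
Qed.

(** * Choice of the grid size and proof of both bounds *)

Lemma exists_root_sandwich (d T : nat) : (0 < d)%N -> (0 < T)%N ->
  exists2 m, (0 < m)%N & (m ^ d <= T < m.+1 ^ d)%N.
Proof.
move=> d0 T0.
have ex : exists n, (T < n ^ d)%N.
  exists T.+1; rewrite -[X in (X < _)%N]expn1.
  by rewrite (leq_ltn_trans (leq_pexp2l _ d0)) // ltn_exp2r.
(* The least n with T < n^d is at least 2 because T > 0; m is its predecessor, the integer part of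
   the d-th root of T. *)
have [n Tn nmin] := ex_minnP ex; case: n => [|[|m]] in Tn nmin *.
- by move: Tn; rewrite exp0n.
- by move: Tn; rewrite exp1n ltnS leqNgt T0.
exists m.+1 => //; rewrite Tn andbT leqNgt.
by apply/negP => /nmin; rewrite ltnn.
Qed.

Unset Implicit Arguments.

Theorem theorem5p2 (R : realType) (d : nat) (hd : (0 < d)%N)
    (sigma : R) (hsigma : 0 < sigma) :
  exists c C eta0 : R, [/\ 0 < c, 0 < C, 0 < eta0 < 1 &
    forall H : function_hilbert_space R 'rV[R]_d,
      is_rkhs_of H (se_kernel sigma) ->
    forall rad eps : R, 0 < rad -> 0 < eps -> eps / rad < eta0 ->
      (forall (T : nat) (pi : det_algorithm R (unit_cube R d)), (0 < T)%N ->
         achieves_regret pi (hball H rad) T eps ->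
         c * ln (rad / eps) `^ (d%:R / 2 - 1) <= T%:R) /\
      (exists (T : nat) (pi : det_algorithm R (unit_cube R d)),
         [/\ (0 < T)%N, T%:R <= C * ln (rad / eps) ^+ d &
             achieves_regret pi (hball H rad) T eps])].
Proof.
have [N hN] := se_upper_bound d sigma.
have [b b0 hb] := se_regret_ge d hsigma.
have d0 : 0 < d%:R :> R by rewrite ltr0n.
(* The first constant inverts lam <= 4 b m^2. The second comes from n <= lam + 1 <= 2 lam and the
   one query after the grid. The third forces lam > N + 1, hence n >= N and lam >= 1. *)
exists ((4 * b) `^ (- (d%:R / 2))), (2 ^+ d + 1), (expR (- N.+1%:R)); split.
- by rewrite powR_gt0 // mulr_gt0.
- by rewrite addr_gt0 ?exprn_gt0.
- by rewrite expR_gt0 -[ltRHS]expR0 ltr_expR oppr_lt0 ltr0n.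
move=> H hk rad eps rad0 eps0 small.
set lam := ln (rad / eps).
have re0 : 0 < rad / eps by rewrite divr_gt0.
have lamE : expR lam = rad / eps by rewrite lnK ?posrE.
have lamN : N.+1%:R < lam.
  rewrite -ltr_expR lamE -[ltRHS]invf_div -[ltLHS]invrK -expRN.
  by rewrite ltf_pV2 // posrE ?expR_gt0 // divr_gt0.
have lam1 : 1 <= lam by apply: le_trans (ltW lamN); rewrite ler1n.
have epsE : eps = rad * expR (- lam).
  by rewrite expRN lamE; field; rewrite !gt_eqF.
split=> [T pi T0 hpi|].
  have [m m0 /andP[mT Tm]] := exists_root_sandwich hd T0.
  have lam_le : lam <= b * m.+1%:R ^+ 2.
    have := hb m.+1 isT H rad eps T pi hk rad0.
    rewrite T0 Tm => /(_ isT hpi); rewrite epsE ler_pM2l // ler_expR.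
    by rewrite lerN2.
  have mR : 1 <= m%:R :> R by rewrite ler1n.
  have muE : lam <= 4 * b * m%:R ^+ 2.
    apply: le_trans lam_le _.
    have : 0 <= b * ((m%:R - 1) * (3 * m%:R + 1)).
      by rewrite !mulr_ge0 ?(ltW b0) //; lra.
    by rewrite -[m.+1]addn1 natrD; lra.
  apply: (@le_trans _ _ (m%:R ^+ d)); last by rewrite -natrX ler_nat.
  have b4 : 0 < 4 * b by rewrite mulr_gt0.
  (* Since lam >= 1, the exponent d/2 - 1 may be raised to d/2, which is what the argument
     yields. *)
  apply: (@le_trans _ _ ((4 * b) `^ (- (d%:R / 2)) * lam `^ (d%:R / 2))).
    by rewrite ler_wpM2l ?powR_ge0 // ler_powR //; lra.
  rewrite powRN mulrC ler_pdivrMr ?powR_gt0 //.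
  have -> : m%:R ^+ d = (m%:R ^+ 2) `^ (d%:R / 2) :> R.
    rewrite -[m%:R ^+ 2]powR_mulrn ?ler0n // -powRrM mulrCA divff // mulr1.
    by rewrite powR_mulrn.
  rewrite mulrC -powRM ?(ltW b4) ?sqr_ge0 //.
  by rewrite ge0_ler_powR ?nnegrE ?mulr_ge0 ?sqr_ge0 ?divr_ge0 //; lra.
(* The least integer above lam, so that rad exp(-n) <= eps. *)
pose n := (Num.truncn lam).+1.
have /andP[nl nu] : n%:R - 1 <= lam < n%:R.
  rewrite /n -natr1 addrK natr1; apply: truncn_itv; lra.
have Nn : (N <= n)%N.
  by rewrite ltnW // -(ltr_nat R) (lt_trans _ nu) // (lt_trans _ lamN) // ltr_nat.
have [pi hpi] := hN n Nn isT H rad hk rad0.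
exists (n ^ d).+1, pi; split=> // [|f bf].
  rewrite -natr1 natrX mulrDl mul1r lerD ?exprn_ege1 // -exprMn.
  by rewrite lerXn2r ?nnegrE //; lra.
apply: le_trans (hpi f bf) _.
by rewrite epsE ler_pM2l // ler_expR lerN2 ltW.
Qed.
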